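(* Let $\hat{\mathcal A}$ be the algebra of differential polynomials equipped with a $\lambda$-bracket $\{\cdot_{\boldsymbol\lambda}\cdot\}$ of rank $d$, and consider the bracket on $\hat{\mathcal A}$ defined by $$\{f,g\}:=\{f_{\boldsymbol\lambda}g\}\big|_{\boldsymbol\lambda=0},\qquad f,g\in\hat{\mathcal A}.$$ Then: (a) this bracket induces a well-defined bracket on the quotient space $\hat{\mathcal F}=\hat{\mathcal A}/\sum_{\alpha=1}^d\partial_\alpha\hat{\mathcal A}$; (b) if the $\lambda$-bracket satisfies the axioms of a ($d$-dimensional) Poisson Vertex Algebra, then the induced bracket on $\hat{\mathcal F}$ is a Lie bracket.
   Context: Let $d,n\ge1$ and let $U$ be a coordinate chart of an $n$-dimensional manifold with coordinates $u^1,\dots,u^n$. $\hat{\mathcal A}$ is the algebra of polynomials in the variables $u^i_I$ ($1\le i\le n$, $I\in\mathbb Z^d_{\ge0}$, $I\neq0$) with coefficients in $C^\infty(U)$; $u^i_0=u^i$. It carries the commuting derivations $\partial_\alpha=\sum_{i,I}u^i_{I+E_\alpha}\frac{\partial}{\partial u^i_I}$, $\alpha=1,\dots,d$ ($E_\alpha$ the $\alpha$-th unit multi-index). Multi-index notation: $\boldsymbol\lambda^N=\prod_\alpha\lambda_\alpha^{N_\alpha}$, $(\boldsymbol\lambda+\boldsymbol\partial)^N=\prod_\alpha(\lambda_\alpha+\partial_\alpha)^{N_\alpha}$. A $\lambda$-bracket of rank $d$ is an $\mathbb R$-bilinear map $\hat{\mathcal A}\times\hat{\mathcal A}\to\mathbb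 R[\lambda_1,\dots,\lambda_d]\otimes\hat{\mathcal A}$, $(f,g)\mapsto\{f_{\boldsymbol\lambda}g\}$, such that for all $f,g,h$ and $\alpha$: $\{\partial_\alpha f_{\boldsymbol\lambda}g\}=-\lambda_\alpha\{f_{\boldsymbol\lambda}g\}$; $\{f_{\boldsymbol\lambda}\partial_\alpha g\}=(\lambda_\alpha+\partial_\alpha)\{f_{\boldsymbol\lambda}g\}$; $\{f_{\boldsymbol\lambda}gh\}=\{f_{\boldsymbol\lambda}g\}h+\{f_{\boldsymbol\lambda}h\}g$; $\{fg_{\boldsymbol\lambda}h\}=\{f_{\boldsymbol\lambda+\boldsymbol\partial}h\}g+\{g_{\boldsymbol\lambda+\boldsymbol\partial}h\}f$. Here, if $\{f_{\boldsymbol\lambda}g\}=\sum_NC_N\boldsymbol\lambda^N$, then $\{f_{\boldsymbol\lambda+\boldsymbol\partial}g\}h:=\sum_NC_N(\boldsymbol\lambda+\boldsymbol\partial)^Nh$. The Poisson Vertex Algebra axioms are, in addition, skewsymmetry, $\{g_{\boldsymbol\lambda}f\}=-\sum_N(-\boldsymbol\lambda-\boldsymbol\partial)^NC_N$ when $\{f_{\boldsymbol\lambda}g\}=\sum_NC_N\boldsymbol\lambda^N$, and the PVA-Jacobi identity $\{f_{\boldsymbol\lambda}\{g_{\boldsymbol\mu}h\}\}-\{g_{\boldsymbol\mu}\{f_{\boldsymbol\lambda}h\}\}=\{\{f_{\boldsymbol\lambda}g\}_{\boldsymbol\lambda+\boldsymbol\mu}h\}$. *)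

(* Defs.v *)
From HB Require Import structures.
From mathcomp Require Import all_boot all_order all_algebra.
From mathcomp Require Import finmap.
From mathcomp Require Import mathcomp_extra boolp classical_sets functions.
From mathcomp Require Import cardinality fsbigop reals topology normedtype.
From mathcomp Require Import derive.
From mathcomp Require Import -(notations) monalg.
From mathcomp Require Import -(notations) mpoly.

Set Implicit Arguments.
Unset Strict Implicit.
Unset Printing Implicit Defensive.

Import Order.TTheory GRing.Theory Num.Theory numFieldNormedType.Exports.
Local Open Scope classical_set_scope.
Local Open Scope ring_scope.
Local Open Scope quotient_scope.

(** * Smooth functions on a coordinate chart *)

(** The coordinates identify the chart with a nonempty open subset of [R^n]. *)
Record chart (R : realType) (n : nat) := Chart {
  chart_dom :> set 'rV[R]_n;
  chart_open : open chart_dom;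
  chart_nonempty : chart_dom !=set0 }.
Arguments chart_open {R n} c.

Section SmoothOn.
Context {R : realType} {n : nat}.
Implicit Types (f g : 'rV[R]_n -> R) (U : set 'rV[R]_n) (i : 'I_n).

Definition partial i f : 'rV[R]_n -> R := fun x => 'D_(delta_mx 0 i) f x.

(** [f] is of class [C^k] on the open set [U]. *)
Fixpoint Ck_on U (k : nat) f : Prop :=
  (forall x, U x -> {for x, continuous f}) /\
  (if k is k'.+1 then
     forall i, (forall x, U x -> derivable f x (delta_mx 0 i)) /\
               Ck_on U k' (partial i f)
   else True).

Definition smooth_on U f : Prop := forall k, Ck_on U k f.

Lemma Ck_on_continuous U k f :
  Ck_on U k f -> forall x, U x -> {for x, continuous f}.
Proof. by case: k => [|k] []. Qed.

Lemma Ck_onS U k f : Ck_on U k.+1 f -> Ck_on U k f.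
Proof.
elim: k f => [|k IH] f; first by case.
by case=> fc fd; split=> // i; have [fdi fCi] := fd i; split=> //; exact: IH.
Qed.

Lemma near_eq_on U f g x : open U -> {in U, f =1 g} -> U x ->
  \forall y \near x, f y = g y.
Proof.
move=> oU fg Ux; have := open_nbhs_nbhs (conj oU Ux).
by apply: filterS => y Uy; apply: fg; rewrite inE.
Qed.

Lemma eq_partial U f g i : open U -> {in U, f =1 g} ->
  {in U, partial i f =1 partial i g}.
Proof.
move=> oU fg x; rewrite inE => Ux.
by apply: near_eq_derive; exact: near_eq_on oU fg Ux.
Qed.

Lemma eq_Ck_on U k f g : open U -> {in U, f =1 g} -> Ck_on U k f -> Ck_on U k g.
Proof.
move=> oU; elim: k f g => [|k IH] f g fg fC.
all: have gc x : U x -> {for x, continuous g} by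
  move=> Ux; rewrite /prop_for /continuous_at -(fg x) ?inE //;
  apply: cvg_trans (Ck_on_continuous fC Ux);
  exact: (near_eq_cvg (near_eq_on oU fg Ux)).
  by split.
split=> // i; have [_ /(_ i) [fdi fCi]] := fC; split.
  by move=> x Ux; apply: near_eq_derivable (fdi x Ux); exact: near_eq_on oU fg Ux.
by apply: IH fCi; exact: eq_partial.
Qed.

Lemma eq_smooth_on U f g : open U -> {in U, f =1 g} ->
  smooth_on U f -> smooth_on U g.
Proof. by move=> oU fg fC k; exact: eq_Ck_on (fC k). Qed.

Lemma smooth_on_partial U f i : smooth_on U f -> smooth_on U (partial i f).
Proof. by move=> fC k; case: (fC k.+1) => _ /(_ i) []. Qed.

Lemma smooth_on_cst U (c : R) : smooth_on U (cst c).
Proof.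
move=> k; elim: k c => [|k IH] c; split=> //;
  try by move=> x _; exact: cst_continuous.
move=> i; split=> [x _|]; first exact: derivable_cst.
suff -> : partial i (cst c) = cst 0 by exact: IH.
by apply/funext => x; rewrite /partial derive_cst.
Qed.

Lemma Ck_onD U k f g : open U ->
  Ck_on U k f -> Ck_on U k g -> Ck_on U k (f \+ g).
Proof.
move=> oU; elim: k f g => [|k IH] f g [fc fd] [gc gd].
all: split=> //; first by move=> x Ux; exact: (cvgD (fc x Ux) (gc x Ux)).
move=> i; have [fdi fCi] := fd i; have [gdi gCi] := gd i.
split=> [x Ux|]; first by apply: derivableD; [exact: fdi | exact: gdi].
apply: eq_Ck_on (IH _ _ fCi gCi) => // x; rewrite inE => Ux.
by rewrite /partial /= deriveD; [by []|exact: fdi | exact: gdi].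
Qed.

Lemma Ck_onM U k f g : open U ->
  Ck_on U k f -> Ck_on U k g -> Ck_on U k (f \* g).
Proof.
move=> oU; elim: k f g => [|k IH] f g fC gC.
all: have [fc fd] := fC; have [gc gd] := gC.
all: split=> //; first by move=> x Ux; exact: (cvgM (fc x Ux) (gc x Ux)).
move=> i; have [fdi fCi] := fd i; have [gdi gCi] := gd i.
split=> [x Ux|]; first by apply: derivableM; [exact: fdi | exact: gdi].
have := Ck_onD oU (IH _ _ (Ck_onS fC) gCi) (IH _ _ (Ck_onS gC) fCi).
apply: eq_Ck_on => // x; rewrite inE => Ux.
by rewrite /partial /= deriveM; [by []|exact: fdi | exact: gdi].
Qed.

Lemma smooth_onD U f g : open U ->
  smooth_on U f -> smooth_on U g -> smooth_on U (f \+ g).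
Proof. by move=> oU fC gC k; apply: Ck_onD. Qed.

Lemma smooth_onM U f g : open U ->
  smooth_on U f -> smooth_on U g -> smooth_on U (f \* g).
Proof. by move=> oU fC gC k; apply: Ck_onM. Qed.

End SmoothOn.

Section SmoothRing.
Context {R : realType} {n : nat}.
Variable U : chart R n.

Definition chart_pt : Type := set_type (chart_dom U).
HB.instance Definition _ := Choice.on chart_pt.

Lemma chart_pt_inhabited : {x : 'rV[R]_n | x \in chart_dom U}.
Proof.
by have /cid [x Ux] := chart_nonempty U; exists x; rewrite inE.
Qed.

HB.instance Definition _ := isPointed.Build chart_pt chart_pt_inhabited.

(** Derivatives of a function on [chart_pt] at a point of the open set [U] do
    not depend on how it is extended outside of [U]. *)
Definition extend (f : chart_pt -> R) : 'rV[R]_n -> R :=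
  fun x => oapp f 0 (insub x : option {x | x \in chart_dom U}).

Lemma extendE f (x : chart_pt) : extend f (val x) = f x.
Proof. by rewrite /extend valK. Qed.

Lemma extend_restrict (h : 'rV[R]_n -> R) :
  {in chart_dom U, extend (fun x => h (val x)) =1 h}.
Proof. by move=> x xU; rewrite /extend insubT. Qed.

Definition smooth : {pred chart_pt -> R} :=
  [pred f | `[< smooth_on U (extend f) >]].

Lemma smooth_restrict (h : 'rV[R]_n -> R) :
  smooth_on U h -> (fun x : chart_pt => h (val x)) \in smooth.
Proof.
move=> hC; apply/asboolP; apply: eq_smooth_on hC; first exact: chart_open.
by move=> x xU; rewrite extend_restrict.
Qed.

Lemma smoothP f : reflect (smooth_on U (extend f)) (f \in smooth).
Proof. exact: asboolP. Qed.

Lemma smooth_cst (c : R) : (fun=> c) \in smooth.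
Proof. by apply: (@smooth_restrict (cst c)); exact: smooth_on_cst. Qed.

Lemma smooth_subring : subring_closed smooth.
Proof.
have oU := chart_open U.
have smM f g : f \in smooth -> g \in smooth -> f * g \in smooth.
  move=> /smoothP fC /smoothP gC; apply/smoothP.
  apply: eq_smooth_on (smooth_onM oU fC gC) => // x.
  by move=> xU; rewrite /extend /= insubT.
split=> //; first exact: smooth_cst.
move=> f g fC gC.
have /smoothP gNC : (fun=> -1) * g \in smooth by exact: smM (smooth_cst _) gC.
move/smoothP: fC => fC; apply/smoothP.
apply: eq_smooth_on (smooth_onD oU fC gNC) => // x xU.
rewrite /extend /= insubT; congr (_ + _); exact: mulN1r.
Qed.

HB.instance Definition _ :=
  GRing.isSubringClosed.Build (chart_pt -> R) smooth smooth_subring.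

(** The algebra [C^oo(U)]. *)
Record Cinf := MkCinf { Cinf_fun :> chart_pt -> R; _ : Cinf_fun \in smooth }.

HB.instance Definition _ := [isSub for Cinf_fun].
HB.instance Definition _ := [Choice of Cinf by <:].
HB.instance Definition _ := [SubChoice_isSubComNzRing of Cinf by <:].

Definition Cinf_cst (c : R) : Cinf := MkCinf (smooth_cst c).

Lemma Cinf_partial_subproof i (f : Cinf) :
  (fun x : chart_pt => partial i (extend f) (val x)) \in smooth.
Proof.
apply: smooth_restrict; apply: smooth_on_partial; apply/smoothP.
exact: (valP f).
Qed.

Definition Cinf_partial i (f : Cinf) : Cinf :=
  MkCinf (Cinf_partial_subproof i f).

End SmoothRing.

Arguments smooth {R n} U _.

Section CinfTheory.
Context {R : realType} {n : nat} {U : chart R n}.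

Lemma Cinf_cst_is_zmod_morphism : zmod_morphism (@Cinf_cst R n U).
Proof. by move=> a b; apply/val_inj. Qed.

Lemma Cinf_cst_is_monoid_morphism : monoid_morphism (@Cinf_cst R n U).
Proof. by split=> [|a b]; apply/val_inj. Qed.

HB.instance Definition _ :=
  GRing.isZmodMorphism.Build R (Cinf U) (@Cinf_cst R n U)
    Cinf_cst_is_zmod_morphism.
HB.instance Definition _ :=
  GRing.isMonoidMorphism.Build R (Cinf U) (@Cinf_cst R n U)
    Cinf_cst_is_monoid_morphism.

Definition Cinf_scale (r : R) (f : Cinf U) : Cinf U := Cinf_cst U r * f.

Fact Cinf_scaleA r s f : Cinf_scale r (Cinf_scale s f) = Cinf_scale (r * s) f.
Proof. by rewrite /Cinf_scale (rmorphM (@Cinf_cst R n U)) mulrA. Qed.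

Fact Cinf_scale1 : left_id 1 Cinf_scale.
Proof. by move=> f; rewrite /Cinf_scale (rmorph1 (@Cinf_cst R n U)) mul1r. Qed.

Fact Cinf_scaleDr : right_distributive Cinf_scale +%R.
Proof. by move=> r f g; rewrite /Cinf_scale mulrDr. Qed.

Fact Cinf_scaleDl f : {morph Cinf_scale^~ f : r s / r + s}.
Proof.
by move=> r s; rewrite /Cinf_scale (rmorphD (@Cinf_cst R n U)) mulrDl.
Qed.

HB.instance Definition _ := GRing.Zmodule_isLmodule.Build R (Cinf U)
  Cinf_scaleA Cinf_scale1 Cinf_scaleDr Cinf_scaleDl.

Fact Cinf_scaleAl (r : R) (f g : Cinf U) : r *: (f * g) = r *: f * g.
Proof. exact: mulrA. Qed.

HB.instance Definition _ :=
  GRing.Lmodule_isLalgebra.Build R (Cinf U) Cinf_scaleAl.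
HB.instance Definition _ := GRing.Lalgebra_isComAlgebra.Build R (Cinf U).

Lemma Cinf_derivable i (f : Cinf U) x :
  chart_dom U x -> derivable (extend f) x (delta_mx 0 i).
Proof.
have /smoothP /(_ 1%N) [_ /(_ i) [fd _]] : val f \in smooth U := valP f.
exact: fd.
Qed.

Lemma Cinf_partialD i : {morph @Cinf_partial R n U i : f g / f + g}.
Proof.
move=> f g; apply/val_inj/funext => x; have Ux := set_mem (valP x).
transitivity (partial i (extend f \+ extend g) (val x)).
  apply: (@eq_partial R n U); [exact: chart_open | move=> y yU | exact: valP].
  by rewrite /extend /= insubT.
exact: deriveD (@Cinf_derivable i f _ Ux) (@Cinf_derivable i g _ Ux).
Qed.

Lemma Cinf_partialM i (f g : Cinf U) :
  Cinf_partial i (f * g) = Cinf_partial i f * g + f * Cinf_partial i g.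
Proof.
apply/val_inj/funext => x; have Ux := set_mem (valP x).
transitivity (partial i (extend f \* extend g) (val x)).
  apply: (@eq_partial R n U); [exact: chart_open | move=> y yU | exact: valP].
  by rewrite /extend /= insubT.
have := deriveM (@Cinf_derivable i f _ Ux) (@Cinf_derivable i g _ Ux).
rewrite /partial => ->; rewrite !extendE addrC /GRing.scale /=.
by congr (_ + _); rewrite mulrC.
Qed.

Lemma Cinf_partial_cst i (c : R) : Cinf_partial i (@Cinf_cst R n U c) = 0.
Proof.
apply/val_inj/funext => x.
transitivity (partial i (cst c : 'rV[R]_n -> R) (val x)); last first.
  by rewrite /partial derive_cst.
apply: (@eq_partial R n U); [exact: chart_open | move=> y yU | exact: valP].
by rewrite /extend /= insubT.
Qed.

Fact Cinf_partial_is_linear i : linear (@Cinf_partial R n U i).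
Proof.
move=> r f g; rewrite Cinf_partialD [X in X + _](Cinf_partialM i) /=.
by rewrite Cinf_partial_cst mul0r add0r.
Qed.

HB.instance Definition _ i :=
  GRing.isLinear.Build R (Cinf U) (Cinf U) *:%R (@Cinf_partial R n U i)
    (Cinf_partial_is_linear i).

End CinfTheory.

(** * Polynomials in arbitrarily many variables *)

Section MalgMap.
Context (K : choiceType) (A : nzRingType).
Variables (t : K -> K) (F : K -> A -> A).
Hypothesis FD : forall k, {morph F k : x y / x + y}.
Implicit Types f g : malg K A.

Let F0 k : F k 0 = 0.
Proof. by apply: (addrI (F k 0)); rewrite -FD !addr0. Qed.

Definition malg_map f : malg K A :=
  \sum_(k <- monalg.msupp f) mkmalgU (t k) (F k (monalg.mcoeff k f)).

Lemma malg_map_widen (e : {fset K}) f : (monalg.msupp f `<=` e)%fset ->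
  malg_map f = \sum_(k <- e) mkmalgU (t k) (F k (monalg.mcoeff k f)).
Proof.
move=> fe; apply: big_fset_incl => // k _ /mcoeff_outdom ->.
by rewrite F0 monalgU0.
Qed.

Lemma malg_map_linear (a : A) f g :
    (forall k c, F k (a * c) = a * F k c) ->
  malg_map (a *: f + g) = a *: malg_map f + malg_map g.
Proof.
move=> Fa; pose h := a *: f + g.
pose e := (monalg.msupp f `|` monalg.msupp g `|` monalg.msupp h)%fset.
rewrite !(@malg_map_widen e).
  rewrite scaler_sumr -big_split; apply: eq_bigr => k _ /=.
  apply/malgP => k'; rewrite !(monalg.mcoeffD, monalg.mcoeffZ, monalg.mcoeffU).
  by rewrite FD Fa mulrnDl mulrnAr.
all: by apply/fsubsetP => k; rewrite !inE => ->; rewrite ?orbT.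
Qed.

End MalgMap.

Section VarPoly.
Context {R : comNzRingType}.
Variables (A : comAlgType R) (V : choiceType).

(** The polynomials in the variables [V] with coefficients in the [R]-algebra
    [A], as an algebra over [R] rather than over [A]. *)
Definition varpoly : Type := malg (cmonom V) A.
HB.instance Definition _ := GRing.ComNzRing.on varpoly.

Implicit Types (f g : varpoly) (r : R) (w : V).

Definition varpoly_scale r f : varpoly := r%:A *: (f : malg (cmonom V) A).

Fact varpoly_scaleA r s f :
  varpoly_scale r (varpoly_scale s f) = varpoly_scale (r * s) f.
Proof. by rewrite /varpoly_scale scalerA -scalerAl mul1r scalerA. Qed.

Fact varpoly_scale1 : left_id 1 varpoly_scale.
Proof. by move=> f; rewrite /varpoly_scale !scale1r. Qed.

Fact varpoly_scaleDr : right_distributive varpoly_scale +%R.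
Proof. by move=> r f g; exact: (scalerDr (r%:A : A) (f : malg (cmonom V) A)). Qed.

Fact varpoly_scaleDl f : {morph varpoly_scale^~ f : r s / r + s}.
Proof.
move=> r s; rewrite /varpoly_scale scalerDl.
exact: (scalerDl (f : malg (cmonom V) A)).
Qed.

HB.instance Definition _ := GRing.Zmodule_isLmodule.Build R varpoly
  varpoly_scaleA varpoly_scale1 varpoly_scaleDr varpoly_scaleDl.

Fact varpoly_scaleAl r f g : r *: (f * g) = r *: f * g.
Proof. exact: (scalerAl (r%:A : A) (f : malg (cmonom V) A)). Qed.

HB.instance Definition _ :=
  GRing.Lmodule_isLalgebra.Build R varpoly varpoly_scaleAl.
HB.instance Definition _ := GRing.Lalgebra_isComAlgebra.Build R varpoly.

Definition var w : varpoly := mkmalgU (ucm w) 1.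

(** The partial derivative with respect to the variable [w]: a monomial [m]
    is sent to [m w] times [m / w]. *)
Definition diff_var w f : varpoly :=
  malg_map (fun m => divcm m (ucm w)) (fun m c => c *+ (m : cmonom V) w) f.

(** The application of [D] to the coefficients. *)
Definition diff_coef (D : A -> A) f : varpoly := malg_map id (fun=> D) f.

Fact diff_var_is_linear w : linear (diff_var w).
Proof.
move=> r f g; apply: (@malg_map_linear (cmonom V) A) => m x.
  by move=> y; rewrite mulrnDl.
by rewrite mulrnAr.
Qed.

Fact diff_coef_is_linear (D : {linear A -> A}) : linear (diff_coef D).
Proof.
move=> r f g; apply: (@malg_map_linear (cmonom V) A) => m x.
  by move=> y; rewrite raddfD.
by rewrite -!scalerAl !mul1r linearZ.
Qed.

HB.instance Definition _ w :=
  GRing.isLinear.Build R varpoly varpoly *:%R (diff_var w)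
    (diff_var_is_linear w).
HB.instance Definition _ (D : {linear A -> A}) :=
  GRing.isLinear.Build R varpoly varpoly *:%R (diff_coef D)
    (diff_coef_is_linear D).

Lemma diff_var_neq0 w f : diff_var w f != 0 ->
  exists2 m, m \in monalg.msupp f & w \in finsupp (cmonom_val m).
Proof.
apply: contra_neqP => H; rewrite /diff_var /malg_map big_seq big1 // => m mf.
suff -> : m w = 0%N by rewrite mulr0n monalgU0.
by apply/eqP; rewrite cmE_eq0; apply/negP => wm; apply: H; exists m.
Qed.

End VarPoly.

Notation "{ 'mpoly' A [ d ] }" := (mpoly d A)
  (at level 0, A, d at level 2, format "{ 'mpoly'  A [ d ] }") : type_scope.

(** * Differential algebras *)

(** The operators [D_a] on the algebra [A] stand for the commuting derivations
    [\partial_a] of the differential polynomials. *)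

Section Functionals.
Context {R : comNzRingType} {A : comAlgType R} {d : nat}.
Variable D : 'I_d -> {linear A -> A}.

(** The subspace [\sum_a D_a A]. *)
Definition total_divs : {pred A} :=
  [pred f | `[< exists g : 'I_d -> A, f = \sum_(a < d) D a (g a) >]].

Lemma total_divsP f :
  reflect (exists g : 'I_d -> A, f = \sum_(a < d) D a (g a))
          (f \in total_divs).
Proof. exact: asboolP. Qed.

Lemma total_divs_linear (r : R) f g :
  f \in total_divs -> g \in total_divs -> r *: f + g \in total_divs.
Proof.
move=> /total_divsP[F ->] /total_divsP[G ->]; apply/total_divsP.
exists (fun a => r *: F a + G a); rewrite scaler_sumr -big_split /=.
by apply: eq_bigr => a _; rewrite linearP.
Qed.

Lemma total_divs0 : 0 \in total_divs.
Proof.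
by apply/total_divsP; exists (fun=> 0); rewrite big1 // => a _; rewrite raddf0.
Qed.

Fact total_divs_zmod_closed : zmod_closed total_divs.
Proof.
split=> [|f g fD gD]; first exact: total_divs0.
by rewrite addrC -scaleN1r; exact: total_divs_linear.
Qed.

HB.instance Definition _ :=
  GRing.isZmodClosed.Build A total_divs total_divs_zmod_closed.

(** The space of local functionals [A / \sum_a D_a A]. *)
Definition functional : Type := {ideal_quot total_divs}.
HB.instance Definition _ := GRing.Zmodule.on functional.

Definition to_functional (f : A) : functional := \pi_({ideal_quot total_divs}) f.

Lemma to_functionalP f g :
  to_functional f = to_functional g <-> f - g \in total_divs.
Proof.
rewrite /to_functional Quotient.idealrBE.
by split=> [/eqP|/eqP].
Qed.

Lemma to_functional_surj (q : functional) : exists f, to_functional f = q.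
Proof. by exists (repr (q : {ideal_quot total_divs})); exact: reprK. Qed.

Fact to_functionalD : {morph to_functional : f g / f + g}.
Proof. exact: (raddfD (\pi_({ideal_quot total_divs}))). Qed.

Definition functional_scale (r : R) (q : functional) : functional :=
  to_functional (r *: repr (q : {ideal_quot total_divs})).

Lemma to_functionalZ r f :
  functional_scale r (to_functional f) = to_functional (r *: f).
Proof.
apply/to_functionalP; rewrite -scalerBr -[_ *: _]addr0.
apply: total_divs_linear total_divs0; apply/to_functionalP.
by rewrite /to_functional reprK.
Qed.

Fact functional_scaleA r s q :
  functional_scale r (functional_scale s q) = functional_scale (r * s) q.
Proof.
by have [f <-] := to_functional_surj q; rewrite !to_functionalZ scalerA.
Qed.

Fact functional_scale1 : left_id 1 functional_scale.
Proof.
by move=> q; have [f <-] := to_functional_surj q; rewrite to_functionalZ scale1r.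
Qed.

Fact functional_scaleDr : right_distributive functional_scale +%R.
Proof.
move=> r p q; have [f <-] := to_functional_surj p.
have [g <-] := to_functional_surj q.
by rewrite -to_functionalD !to_functionalZ scalerDr to_functionalD.
Qed.

Fact functional_scaleDl q : {morph functional_scale^~ q : r s / r + s}.
Proof.
move=> r s; have [f <-] := to_functional_surj q.
by rewrite !to_functionalZ scalerDl to_functionalD.
Qed.

HB.instance Definition _ := GRing.Zmodule_isLmodule.Build R functional
  functional_scaleA functional_scale1 functional_scaleDr functional_scaleDl.

Fact to_functional_is_linear : linear to_functional.
Proof. by move=> r f g; rewrite to_functionalD -to_functionalZ. Qed.

HB.instance Definition _ :=
  GRing.isLinear.Build R A functional *:%R to_functional
    to_functional_is_linear.

End Functionals.

(** * Lambda-brackets *)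

Section LambdaBracket.
Context {R : comNzRingType} {A : comAlgType R} {d : nat}.
Variable D : 'I_d -> {linear A -> A}.

(** [P |-> (lambda_a + D_a) P], with [D_a] acting on the coefficients of [P]. *)
Definition lam_der (a : 'I_d) (P : {mpoly A[d]}) : {mpoly A[d]} :=
  mpolyX A (mnm1 a) * P + map_mpoly (D a) P.

(** [E^N = \prod_a (E_a)^(N_a)] for commuting operators [E_a]; the order of
    composition then does not matter. *)
Definition oppow (T : Type) (E : 'I_d -> T -> T) (N : multinom d) : T -> T :=
  fun x => foldr (fun a => iter (N a) (E a)) x (enum 'I_d).

(** [{f_(lambda + D) g} h] when [P = {f_lambda g}]. *)
Definition bracket_at_der (P : {mpoly A[d]}) (h : A) : {mpoly A[d]} :=
  \sum_(N <- msupp P) mcoeff N P *: oppow lam_der N (mpolyC d h).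

(** [\sum_N (- lambda - D)^N C_N] when [P = \sum_N C_N lambda^N]. *)
Definition bracket_adjoint (P : {mpoly A[d]}) : {mpoly A[d]} :=
  \sum_(N <- msupp P)
    oppow (fun a Q => - lam_der a Q) N (mpolyC d (mcoeff N P)).

Record lambda_bracket (br : A -> A -> {mpoly A[d]}) : Prop := LambdaBracket {
  lb_linearl : forall (r : R) f g h,
    br (r *: f + g) h = r%:A *: br f h + br g h;
  lb_linearr : forall (r : R) f g h,
    br f (r *: g + h) = r%:A *: br f g + br f h;
  lb_derl : forall a f g, br (D a f) g = - (mpolyX A (mnm1 a) * br f g);
  lb_derr : forall a f g, br f (D a g) = lam_der a (br f g);
  lb_leibnizr : forall f g h, br f (g * h) = h *: br f g + g *: br f h;
  lb_leibnizl : forall f g h,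
    br (f * g) h = bracket_at_der (br f h) g + bracket_at_der (br g h) f
}.

Definition lb_skewsymmetric (br : A -> A -> {mpoly A[d]}) : Prop :=
  forall f g, br g f = - bracket_adjoint (br f g).

Definition lam (a : 'I_d) : {mpoly A[d + d]} := mpolyX A (mnm1 (lshift d a)).
Definition mu (a : 'I_d) : {mpoly A[d + d]} := mpolyX A (mnm1 (rshift d a)).

(** [\sum_N C_N x^N] when [P = \sum_N C_N lambda^N]. *)
Definition subst_lam (x : 'I_d -> {mpoly A[d + d]}) (P : {mpoly A[d]}) :
  {mpoly A[d + d]} := mmap (@mpolyC (d + d) A) x P.

(** Each bracket with an inner bracket is extended to polynomials
    coefficientwise: [{f_lambda {g_mu h}} = \sum_N {f_lambda C_N} mu^N] when
    [{g_mu h} = \sum_N C_N mu^N], and [{{f_lambda g}_(lambda + mu) h} =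
    \sum_N lambda^N {C_N _(lambda + mu) h}] when
    [{f_lambda g} = \sum_N C_N lambda^N]. *)
Definition lb_jacobi (br : A -> A -> {mpoly A[d]}) : Prop :=
  forall f g h,
    mmap (fun c => subst_lam lam (br f c)) mu (br g h) -
    mmap (fun c => subst_lam mu (br g c)) lam (br f h) =
    mmap (fun c => subst_lam (fun a => lam a + mu a) (br c h)) lam (br f g).

Record poisson_vertex_algebra (br : A -> A -> {mpoly A[d]}) : Prop :=
  PoissonVertexAlgebra {
    pva_lambda_bracket : lambda_bracket br;
    pva_skewsymmetric : lb_skewsymmetric br;
    pva_jacobi : lb_jacobi br
  }.

(** [{f, g} = {f_lambda g} |_(lambda = 0)] *)
Definition bracket0 (br : A -> A -> {mpoly A[d]}) (f g : A) : A :=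
  meval (fun=> 0) (br f g).

Definition induced_by (br : A -> A -> {mpoly A[d]})
    (B : functional D -> functional D -> functional D) : Prop :=
  forall f g, B (to_functional D f) (to_functional D g) =
    to_functional D (bracket0 br f g).

End LambdaBracket.

(** * Lie brackets *)

Definition bilinear_bracket (R : nzRingType) (V : lmodType R)
    (B : V -> V -> V) : Prop :=
  (forall x, linear (B x)) /\ (forall y, linear (B^~ y)).

Record lie_bracket (R : nzRingType) (V : lmodType R) (B : V -> V -> V) : Prop :=
  LieBracket {
    lie_bilinear : bilinear_bracket B;
    lie_alternating : forall x, B x x = 0;
    lie_jacobi : forall x y z, B x (B y z) + B y (B z x) + B z (B x y) = 0
  }.

(** * Differential polynomials *)

(** A pair [(i, I)] stands for the jet coordinate [u^i_I]; it is a polynomial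
    variable only when [I <> 0], the [u^i_0 = u^i] being the coordinates on
    [U]. *)
Notation jet n d := ('I_n * multinom d)%type.

Definition jetvar (n d : nat) : Type := {v : jet n d | v.2 != mnm0}.
HB.instance Definition _ n d := SubChoice.on (jetvar n d).

Lemma jet_shift_subproof n d (a : 'I_d) (v : jet n d) :
  mnm_add v.2 (mnm1 a) != mnm0.
Proof. by rewrite -mdeg_eq0 mdegD mdeg1 addn1. Qed.

(** [(i, I) |-> (i, I + E_a)] *)
Definition jet_shift n d (a : 'I_d) (v : jet n d) : jetvar n d :=
  exist _ (v.1, mnm_add v.2 (mnm1 a)) (jet_shift_subproof a v).

Section DiffPoly.
Context {R : realType} {n : nat}.
Variables (U : chart R n) (d : nat).

Definition diffpoly : Type := varpoly (Cinf U) (jetvar n d).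
HB.instance Definition _ := GRing.ComAlgebra.on diffpoly.

Implicit Types (f g : diffpoly) (r : R).

(** [\partial / \partial u^i_I] for [v = (i, I)]. *)
Definition diff_jet (v : jet n d) : diffpoly -> diffpoly :=
  if insub v is Some w then @diff_var R (Cinf U) (jetvar n d) w
  else @diff_coef R (Cinf U) (jetvar n d) (Cinf_partial v.1).

Fact diff_jet_is_linear v : linear (diff_jet v).
Proof.
by rewrite /diff_jet; case: insub => [w|];
  [exact: diff_var_is_linear | exact: diff_coef_is_linear].
Qed.

HB.instance Definition _ v :=
  GRing.isLinear.Build R diffpoly diffpoly *:%R (diff_jet v)
    (diff_jet_is_linear v).

Lemma diff_jet_finite f : finite_set [set v | diff_jet v f != 0].
Proof.
pose vars := (\bigcup_(m <- monalg.msupp f) finsupp (cmonom_val m))%fset.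
pose s : seq (jet n d) :=
  [seq (i, mnm0) | i <- enum 'I_n] ++ [seq val w | w <- vars].
apply: (@sub_finite_set _ _ [set` s]); last exact: finite_seq.
move=> v /=; rewrite mem_cat /diff_jet; case: insubP => [w _ <-|/negPn/eqP v0 _].
  move=> /diff_var_neq0[m mf wm]; apply/orP; right.
  by apply: map_f; apply/bigfcupP; exists m => //; rewrite mf.
apply/orP; left; apply/mapP; exists v.1; first by rewrite mem_enum.
by rewrite -v0; case: v {v0}.
Qed.

(** The total derivative [\partial_a]. By [diff_jet_finite] the sum has only
    finitely many nonzero terms, so the library's finitely supported sum does
    not take its default value. *)
Definition total_der (a : 'I_d) f : diffpoly :=
  \sum_(v \in [set: jet n d])
    @var R (Cinf U) (jetvar n d) (jet_shift a v) * diff_jet v f.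

Definition jet_support f : {fset jet n d} :=
  fset_set [set v | diff_jet v f != 0].

Lemma total_der_fset (s : {fset jet n d}) a f : (jet_support f `<=` s)%fset ->
  total_der a f = \sum_(v <- s)
    @var R (Cinf U) (jetvar n d) (jet_shift a v) * diff_jet v f.
Proof.
move=> /fsubsetP fs; apply: fsbigTE => v; apply: contraNeq => nz0; apply: fs.
rewrite in_fset_set; last exact: diff_jet_finite.
by rewrite inE; apply: contraNneq nz0 => ->; rewrite mulr0.
Qed.

Fact total_der_is_linear a : linear (total_der a).
Proof.
move=> r f g.
pose s := (jet_support f `|` (jet_support g `|` jet_support (r *: f + g)%R))%fset.
have fs : (jet_support f `<=` s)%fset by exact: fsubsetUl.
have gs : (jet_support g `<=` s)%fset.
  exact: fsubset_trans (fsubsetUl _ _) (fsubsetUr _ _).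
have hs : (jet_support (r *: f + g)%R `<=` s)%fset.
  exact: fsubset_trans (fsubsetUr _ _) (fsubsetUr _ _).
rewrite (total_der_fset _ fs) (total_der_fset _ gs) (total_der_fset _ hs).
rewrite scaler_sumr -big_split; apply: eq_bigr => v _.
by rewrite linearP mulrDr scalerAr.
Qed.

HB.instance Definition _ a :=
  GRing.isLinear.Build R diffpoly diffpoly *:%R (total_der a)
    (total_der_is_linear a).

Definition dpartial (a : 'I_d) : {linear diffpoly -> diffpoly} :=
  GRing.Linear.clone R diffpoly diffpoly *:%R (total_der a) _.

End DiffPoly.

Arguments dpartial {R n} U d a.
Notation local_functional U d := (functional (dpartial U d)).

(* Main.v *)
(** Evaluation at [lambda = 0] picks the coefficient of [lambda^0]. It kills
    [{D_a f_lambda g} = - lambda_a {f_lambda g}] and sends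
    [{f_lambda D_a g} = (lambda_a + D_a) {f_lambda g}] to a total derivative,
    so the bracket descends to functionals. In the skewsymmetry axiom every
    [(- lambda - D)^N C_N] with [N <> 0] becomes a total derivative, and the
    PVA-Jacobi identity at [lambda = mu = 0] is the Leibniz form of the Jacobi
    identity, already in the algebra itself. *)
From HB Require Import structures.
Require Import Defs.
From mathcomp Require Import all_boot all_order all_algebra.
From mathcomp Require Import boolp reals.
From mathcomp Require Import -(notations) mpoly.

Set Implicit Arguments.
Unset Strict Implicit.
Unset Printing Implicit Defensive.

Import GRing.Theory.
Local Open Scope ring_scope.

Lemma mnm_neq0 (d : nat) (m : multinom d) :
  m != mnm0 -> exists i, m i != 0%N.
Proof.
move=> m0; apply/existsP; apply: contraNT m0; rewrite negb_exists => /forallP m0.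
by apply/eqP/mnmP => i; rewrite mnm0E; apply/eqP; rewrite -[_ == _]negbK.
Qed.

(** [h] need not be additive, so that the nested brackets of [lb_jacobi] are
    covered directly; [S'] is the target of an evaluation at zero. *)
Lemma rmorph_mmap_var0 (A S S' : comNzRingType) (d : nat)
    (phi : {rmorphism S -> S'}) (h : A -> S) (x : 'I_d -> S) (P : {mpoly A[d]}) :
    phi (h 0) = 0 -> (forall a, phi (x a) = 0) ->
  phi (mmap h x P) = phi (h (mcoeff mnm0 P)).
Proof.
move=> h0 x0; rewrite /mmap raddf_sum /=.
have mon0 m : m != mnm0 -> phi (mmap1 x m) = 0.
  move=> /mnm_neq0[i mi]; rewrite /mmap1 rmorph_prod /=.
  by rewrite (bigD1 i) //= rmorphXn /= x0 expr0n (negPf mi) mul0r.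
have [P0|P0] := boolP (mnm0 \in msupp P).
  rewrite (bigD1_seq mnm0) ?msupp_uniq //= big1 ?addr0 => [|m m0].
    by rewrite mmap11 mulr1.
  by rewrite rmorphM /= mon0 ?mulr0.
(* With no constant monomial in the support, the right-hand side is [phi (h 0)]; this is where [h0]
   replaces additivity of [h]. *)
rewrite (memN_msupp_eq0 P0) h0 big_seq big1 // => m mP.
by rewrite rmorphM /= mon0 ?mulr0 //; apply: contraNneq P0 => <-.
Qed.

Lemma meval0E (A : comNzRingType) (d : nat) (P : {mpoly A[d]}) :
  meval (fun=> 0) P = mcoeff mnm0 P.
Proof. exact: (@rmorph_mmap_var0 A A A d idfun idfun). Qed.

Section Bracket0.
Context {R : comNzRingType} {A : comAlgType R} {d : nat}.
Variable D : 'I_d -> {linear A -> A}.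
Implicit Types (P : {mpoly A[d]}) (f g h : A).

Lemma lam_der_coef0 a P : mcoeff mnm0 (lam_der D a P) = D a (mcoeff mnm0 P).
Proof.
rewrite /lam_der mcoeffD mcoeff_map_mpoly /= -meval0E rmorphM /= mevalXU.
by rewrite mul0r add0r.
Qed.

Lemma total_divs_der a f : D a f \in total_divs D.
Proof.
apply/total_divsP; exists (fun b => if b == a then f else 0).
rewrite (bigD1 a) //= eqxx big1 ?addr0 // => b /negPf->.
by rewrite raddf0.
Qed.

(** The outermost operator of the composition is some [- lam_der D a] with [N a] nonzero, and the
    constant coefficient of its output is a value of [- D a]. *)
Lemma adjoint_term_coef0 (N : multinom d) f : N != mnm0 ->
  mcoeff mnm0 (oppow (fun a Q => - lam_der D a Q) N (mpolyC d f))
    \in total_divs D.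
Proof.
move=> /mnm_neq0[i Ni]; rewrite /oppow.
(* The induction runs over any list containing [i]: entries with zero exponent are skipped, and [i]
   ensures that the list is not exhausted. *)
have : i \in enum 'I_d by rewrite mem_enum.
elim: (enum 'I_d) => //= a s IH; rewrite inE => ias.
case Na: (N a) => [|k] /=; last first.
  by rewrite mcoeffN lam_der_coef0 rpredN total_divs_der.
apply: IH; case/predU1P: ias => // ia.
by move: Ni; rewrite ia Na.
Qed.

Lemma bracket_adjoint_coef0 P :
  mcoeff mnm0 (bracket_adjoint D P) - mcoeff mnm0 P \in total_divs D.
Proof.
have op0 f : oppow (fun a Q => - lam_der D a Q) mnm0 (mpolyC d f) = mpolyC d f.
  rewrite /oppow; elim: (enum 'I_d) => //= a s ->.
  by rewrite mnm0E.
rewrite /bracket_adjoint raddf_sum /=.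
have [P0|P0] := boolP (mnm0 \in msupp P).
  rewrite (bigD1_seq mnm0) ?msupp_uniq //= op0 mcoeffC eqxx mulr1 addrAC subrr add0r.
  by apply: rpred_sum => N; exact: adjoint_term_coef0.
rewrite (memN_msupp_eq0 P0) subr0 big_seq; apply: rpred_sum => N NP.
by apply: adjoint_term_coef0; apply: contraNneq P0 => <-.
Qed.

Variable br : A -> A -> {mpoly A[d]}.

Lemma bracket0E f g : bracket0 br f g = mcoeff mnm0 (br f g).
Proof. exact: meval0E. Qed.

Section LambdaBracket.
Hypothesis br_lambda : lambda_bracket D br.

Lemma bracket0_linearr f : linear (bracket0 br f).
Proof.
move=> r g h; rewrite !bracket0E (lb_linearr br_lambda) mcoeffD mcoeffZ.
by rewrite mulr_algl.
Qed.

(** The swapped arguments let linearity in the first one be declared as an instance. *)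
Definition bracket0l g f := bracket0 br f g.

Lemma bracket0_linearl g : linear (bracket0l g).
Proof.
move=> r f h; rewrite /bracket0l !bracket0E (lb_linearl br_lambda) mcoeffD mcoeffZ.
by rewrite mulr_algl.
Qed.

HB.instance Definition _ f :=
  GRing.isLinear.Build R A A *:%R (bracket0 br f) (bracket0_linearr f).
HB.instance Definition _ g :=
  GRing.isLinear.Build R A A *:%R (bracket0l g) (bracket0_linearl g).

(** Together with [bracket00r], this supplies the condition [phi (h 0) = 0] of [rmorph_mmap_var0]
    for the nested brackets of the Jacobi identity. *)
Lemma bracket0r0 f : bracket0 br f 0 = 0.
Proof. exact: raddf0. Qed.

Lemma bracket00r g : bracket0 br 0 g = 0.
Proof. exact: (raddf0 (bracket0l g)). Qed.

Lemma bracket0_divsr f g :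
  g \in total_divs D -> bracket0 br f g \in total_divs D.
Proof.
move=> /total_divsP[G ->]; rewrite raddf_sum; apply: rpred_sum => a _.
by rewrite /= bracket0E (lb_derr br_lambda) lam_der_coef0 total_divs_der.
Qed.

Lemma bracket0_divsl f g : f \in total_divs D -> bracket0 br f g = 0.
Proof.
move=> /total_divsP[F ->].
rewrite -[LHS]/((bracket0l g) _) raddf_sum big1 //= => a _.
rewrite /bracket0l /bracket0 (lb_derl br_lambda) rmorphN rmorphM /=.
by rewrite mevalXU mul0r oppr0.
Qed.

Lemma induced_by_exists : exists B, induced_by (D := D) br B.
Proof.
pose s (p : functional D) := projT1 (cid (to_functional_surj p)).
have sK p : to_functional D (s p) = p by rewrite /s; case: cid.
exists (fun p q => to_functional D (bracket0 br (s p) (s q))) => f g.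
apply/to_functionalP.
have fD : s (to_functional D f) - f \in total_divs D by apply/to_functionalP.
have gD : s (to_functional D g) - g \in total_divs D by apply/to_functionalP.
(* The representatives are exchanged one at a time: the left exchange leaves the value in [A]
   unchanged, the right one alters it by a total divergence. *)
have := bracket0_divsl (s (to_functional D g)) fD.
rewrite -[LHS]/((bracket0l _) _) raddfB /= /bracket0l => /subr0_eq ->.
by rewrite -raddfB; exact: bracket0_divsr.
Qed.

Lemma induced_by_bilinear B : induced_by (D := D) br B -> bilinear_bracket B.
Proof.
move=> BE; split=> p r q1 q2; have [f <-] := to_functional_surj p;
  have [g <-] := to_functional_surj q1; have [h <-] := to_functional_surj q2.
  by rewrite -linearP !BE linearP /= linearP.
(* Here the fixed [p] is the right argument, so the linear map is [bracket0l f]. *)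
rewrite -linearP !BE -linearP; congr to_functional.
exact: (linearP (bracket0l f)).
Qed.

End LambdaBracket.

Lemma induced_by_unique B B' :
  induced_by (D := D) br B -> induced_by br B' -> B = B'.
Proof.
move=> BE BE'; apply/funext => p; apply/funext => q.
have [f <-] := to_functional_surj p; have [g <-] := to_functional_surj q.
by rewrite BE BE'.
Qed.

(** The sign change is obtained on the quotient: in [A], the adjoint adds total derivatives to the
    constant coefficient. *)
Lemma induced_by_anticomm B : lb_skewsymmetric D br ->
  induced_by (D := D) br B -> forall p q, B q p = - B p q.
Proof.
move=> skew BE p q.
have [f <-] := to_functional_surj p; have [g <-] := to_functional_surj q.
rewrite !BE !bracket0E skew -[RHS]raddfN; apply/to_functionalP.
by rewrite mcoeffN opprK addrC -opprB rpredN bracket_adjoint_coef0.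
Qed.

Lemma bracket0_jacobi : lambda_bracket D br -> lb_jacobi br ->
  forall f g h, bracket0 br f (bracket0 br g h) -
    bracket0 br g (bracket0 br f h) = bracket0 br (bracket0 br f g) h.
Proof.
move=> br_lambda jac f g h; have := congr1 (meval (fun=> 0)) (jac f g h).
have lam0 a : meval (fun=> 0 : A) (lam a : {mpoly A[d + d]}) = 0 by exact: mevalXU.
have mu0 a : meval (fun=> 0 : A) (mu a : {mpoly A[d + d]}) = 0 by exact: mevalXU.
have lm0 a : meval (fun=> 0 : A) (lam a + mu a : {mpoly A[d + d]}) = 0.
  by rewrite raddfD /= lam0 mu0 addr0.
have b0r u : mcoeff mnm0 (br u 0) = 0.
  by rewrite -bracket0E (bracket0r0 br_lambda).
have b0l u : mcoeff mnm0 (br 0 u) = 0.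
  by rewrite -bracket0E (bracket00r br_lambda).
(* Each term is reduced twice, at the outer sum and then inside [subst_lam], which leaves a constant
   coefficient of a bracket with a constant coefficient. *)
by rewrite mevalB !rmorph_mmap_var0 //= !mevalC ?b0r ?b0l // !bracket0E.
Qed.

End Bracket0.

Section FunctionalBracket.
Context {F : numFieldType} {A : comAlgType F} {d : nat}.
Variables (D : 'I_d -> {linear A -> A}) (br : A -> A -> {mpoly A[d]}).

Lemma induced_bracket_exists_unique : lambda_bracket D br ->
  exists! B : functional D -> functional D -> functional D,
    bilinear_bracket B /\ induced_by br B.
Proof.
move=> br_lambda; have [B BE] := induced_by_exists br_lambda; exists B.
split=> [|B' [_ BE']]; last exact: induced_by_unique BE BE'.
by have Bbil := induced_by_bilinear br_lambda BE.
Qed.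

Lemma induced_bracket_lie : poisson_vertex_algebra D br ->
  forall B : functional D -> functional D -> functional D,
    induced_by br B -> lie_bracket B.
Proof.
move=> [br_lambda skew jac] B BE.
have Bbil := induced_by_bilinear br_lambda BE.
have BN := induced_by_anticomm skew BE.
split=> // [p|p q r].
  (* Anticommutativity only kills twice [B p p]; 2 is invertible in the numeric field [F]. *)
  have BB : B p p *+ 2 = 0 by rewrite mulr2n {1}BN addNr.
  have := congr1 ( *:%R (2%:R^-1 : F)) BB.
  by rewrite -scaler_nat scalerA mulVf ?Num.Theory.pnatr_eq0 // scale1r scaler0.
have J : B p (B q r) - B q (B p r) = B (B p q) r.
  have [f <-] := to_functional_surj p; have [g <-] := to_functional_surj q.
  have [h <-] := to_functional_surj r.
  by rewrite !BE -raddfB /= (bracket0_jacobi br_lambda jac).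
(* To pass from the Leibniz form [J] to the cyclic form, the sign of the inner swap must come out of
   [B q], which is packed as a linear map for this. *)
have BqN : B q (B r p) = - B q (B p r).
  have [/(_ q) Bq _] := Bbil.
  pose L : {linear functional D -> functional D} :=
    HB.pack (B q) (GRing.isLinear.Build _ _ _ _ (B q) Bq).
  by rewrite (BN p r); exact: (raddfN L).
by rewrite BqN (BN (B p q) r) J subrr.
Qed.

End FunctionalBracket.

Theorem theorem2 (R : realType) (n d : nat) (n_gt0 : (0 < n)%N)
    (d_gt0 : (0 < d)%N) (U : chart R n)
    (br : diffpoly U d -> diffpoly U d -> {mpoly (diffpoly U d)[d]})
    (br_lambda : lambda_bracket (dpartial U d) br) :
  (exists! B : local_functional U d -> local_functional U d ->
       local_functional U d,
     bilinear_bracket B /\ induced_by br B) /\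
  (poisson_vertex_algebra (dpartial U d) br ->
   forall B : local_functional U d -> local_functional U d ->
       local_functional U d,
     induced_by br B -> lie_bracket B).
Proof.
split; first exact: induced_bracket_exists_unique br_lambda.
exact: induced_bracket_lie.
Qed.
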